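(* Let $V$ be a commutative valuation domain with quotient field $F$ such that $J(V)$ is a principal ideal of $V$, let $K/F$ be a finite Galois extension with group $G$, $S$ the integral closure of $V$ in $K$, and $f:G\times G\to S\setminus\{0\}$ a normalized $2$-cocycle. Then $O_l(J_G(A_f))=A_f$ if and only if $f(\sigma,\sigma^{-1})\notin M^2$ for every $\sigma\in G$ and every maximal ideal $M$ of $S$, if and only if $f(\sigma,\tau)\notin M^2$ for every $\sigma,\tau\in G$ and every maximal ideal $M$ of $S$.
   Context: $V$ has arbitrary Krull dimension. A normalized 2-cocycle satisfies $\sigma(f(\tau,\gamma))f(\sigma,\tau\gamma)=f(\sigma,\tau)f(\sigma\tau,\gamma)$, $f(1,\sigma)=f(\sigma,1)=1$; values need not be units. $A_f=\bigoplus_{\sigma\in G}Sx_\sigma$ (free left $S$-module) with $(sx_\sigma)(tx_\tau)=s\,\sigma(t)f(\sigma,\tau)x_{\sigma\tau}$, an order in $\Sigma_f=\bigoplus_\sigma Kx_\sigma=(K/F,G,f)$, $G$-graded with components $Sx_\sigma$. $J_G(A_f)$ is the graded Jacobson radical (intersection of graded left ideals maximal among proper graded left ideals). $O_l(I)=\{x\in\Sigma_f:xI\subseteq I\}$. *)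

(* Defs.v *)
From HB Require Import structures.
From mathcomp Require Import all_boot all_order all_algebra all_fingroup all_field.
Set Implicit Arguments. Unset Strict Implicit. Unset Printing Implicit Defensive.
Import GRing.Theory.
Local Open Scope ring_scope.

Definition is_subring (R : nzRingType) (V : R -> Prop) : Prop :=
  [/\ V 0, V 1, (forall x y, V x -> V y -> V (x - y)) &
      (forall x y, V x -> V y -> V (x * y))].

(* V is a valuation domain of F whose quotient field is F: V is a subring
   of F and for every nonzero x in F, x \in V or x^-1 \in V.  (Then every
   x in F is a quotient of elements of V, so F = Frac V.) *)
Definition valuation_ring (F : fieldType) (V : F -> Prop) : Prop :=
  is_subring V /\ forall x : F, x != 0 -> V x \/ V x^-1.

Definition jacobson_val (F : fieldType) (V : F -> Prop) (x : F) : Prop :=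
  V x /\ (x = 0 \/ ~ V x^-1).

Definition jacobson_principal (F : fieldType) (V : F -> Prop) : Prop :=
  exists p : F, V p /\ forall x, jacobson_val V x <-> exists v, V v /\ x = v * p.

Definition integral_over (F : fieldType) (L : fieldExtType F) (V : F -> Prop)
  (x : L) : Prop :=
  exists p : {poly F}, p \is monic /\ (forall i, V p`_i) /\
    root (map_poly (in_alg L) p) x.

Definition is_ideal_in (L : nzRingType) (S I : L -> Prop) : Prop :=
  [/\ forall x, I x -> S x, I 0,
      (forall x y, I x -> I y -> I (x - y)) &
      (forall s x, S s -> I x -> I (s * x))].

Definition maximal_ideal_in (L : nzRingType) (S M : L -> Prop) : Prop :=
  [/\ is_ideal_in S M, ~ M 1 &
      forall N, is_ideal_in S N -> (forall x, M x -> N x) -> ~ N 1 ->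
        forall x, N x <-> M x].

Definition ideal_sq (L : nzRingType) (M : L -> Prop) (x : L) : Prop :=
  exists s : seq (L * L), (forall ab, ab \in s -> M ab.1 /\ M ab.2) /\
    x = \sum_(ab <- s) ab.1 * ab.2.

(* mathcomp's product on gal_of satisfies (s * t) a = t (s a); the paper's
   product sigma tau is the composition sigma o tau. *)
Definition gcomp (F : fieldType) (L : splittingFieldType F)
  (s t : gal_of {: L}) : gal_of {: L} := (t * s)%g.

Definition cocycle2 (F : fieldType) (L : splittingFieldType F)
  (f : gal_of {: L} -> gal_of {: L} -> L) : Prop :=
  (forall s t g : gal_of {: L}, s (f t g) * f s (gcomp t g) = f s t * f (gcomp s t) g) /\
  (forall s : gal_of {: L}, f 1%g s = 1 /\ f s 1%g = 1).

(* An element sum_sigma a_sigma x_sigma is represented by its coefficient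
   function sigma |-> a_sigma. *)
Definition cp (F : fieldType) (L : splittingFieldType F) :=
  {ffun gal_of {: L} -> L}.

Definition cp_mul (F : fieldType) (L : splittingFieldType F)
  (f : gal_of {: L} -> gal_of {: L} -> L) (a b : cp L) : cp L :=
  [ffun r => \sum_(s : gal_of {: L}) \sum_(t : gal_of {: L} | gcomp s t == r)
               a s * s (b t) * f s t].

Definition cp_add (F : fieldType) (L : splittingFieldType F) (a b : cp L) : cp L :=
  [ffun r => a r + b r].
Definition cp_sub (F : fieldType) (L : splittingFieldType F) (a b : cp L) : cp L :=
  [ffun r => a r - b r].
Definition cp_zero (F : fieldType) (L : splittingFieldType F) : cp L :=
  [ffun _ => 0].

Definition cp_comp (F : fieldType) (L : splittingFieldType F) (a : cp L)
  (s : gal_of {: L}) : cp L := [ffun r => if r == s then a s else 0].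

Definition Af (F : fieldType) (L : splittingFieldType F) (S : L -> Prop)
  (a : cp L) : Prop := forall s, S (a s).

Definition graded_left_ideal (F : fieldType) (L : splittingFieldType F)
  (S : L -> Prop) (f : gal_of {: L} -> gal_of {: L} -> L) (I : cp L -> Prop) :=
  [/\ forall x, I x -> Af S x, I (cp_zero L),
      (forall x y, I x -> I y -> I (cp_sub x y)),
      (forall a x, Af S a -> I x -> I (cp_mul f a x)) &
      (forall x s, I x -> I (cp_comp x s))].

Definition proper_in (F : fieldType) (L : splittingFieldType F)
  (S : L -> Prop) (I : cp L -> Prop) := exists a, Af S a /\ ~ I a.

Definition max_graded_left_ideal (F : fieldType) (L : splittingFieldType F)
  (S : L -> Prop) (f : gal_of {: L} -> gal_of {: L} -> L) (I : cp L -> Prop) :=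
  [/\ graded_left_ideal S f I, proper_in S I &
      forall I', graded_left_ideal S f I' -> proper_in S I' ->
        (forall x, I x -> I' x) -> forall x, I' x <-> I x].

Definition graded_jacobson (F : fieldType) (L : splittingFieldType F)
  (S : L -> Prop) (f : gal_of {: L} -> gal_of {: L} -> L) (x : cp L) : Prop :=
  Af S x /\ forall I, max_graded_left_ideal S f I -> I x.

Definition left_order (F : fieldType) (L : splittingFieldType F)
  (f : gal_of {: L} -> gal_of {: L} -> L) (I : cp L -> Prop) (x : cp L) : Prop :=
  forall y, I y -> I (cp_mul f x y).

(* Main.v *)
(* Let h(s) = f(s, s^-1), write M for the maximal ideals of S, and let p generate
   J(V).  The largest graded left ideal of A_f with component inside M in degree 1
   is maximal graded, whence J_G(A_f) = { a | a_s h(s) \in J(S) for all s }.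
   The ring S is Pruefer: its localizations S_M are valuation rings of L.

   If h(s) is never in M^2, then h(s) divides every element of J(S); multiplying
   x in O_l(J_G(A_f)) by the elements (s^-1)(j / h(s)) x_{s^-1} of J_G(A_f), for j
   in J(S), gives x_s J(S) <= J(S), and this forces x_s \in S since p \in J(S).

   Conversely S / pS is Artinian, so there is k \notin S with k M <= S.  If
   h(s) \in M^2, replace s by an element above it that is maximal for the preorder
   s <= r :<-> f(s, s^-1 r) \notin M; then k x_s \in O_l(J_G(A_f)).

   The last equivalence follows from s(h(t)) = f(s, t) f(st, t^-1).

   Finite ramification enters through one fact only: among dim L + 1 elements of L
   there is an F-linear relation with coefficients in V, one of them equal to 1. *)

Require Import Defs.
From HB Require Import structures.
From mathcomp Require Import all_boot all_order all_algebra all_fingroup all_field.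
From mathcomp Require Import boolp classical_sets.
From mathcomp Require Import ring.
Set Implicit Arguments. Unset Strict Implicit. Unset Printing Implicit Defensive.
Import GRing.Theory.
Local Open Scope ring_scope.

(** * Integral closures *)

Section Subring.
Variables (R : nzRingType) (A : R -> Prop) (subA : is_subring A).

Lemma subring0 : A 0. Proof. by case: subA. Qed.
Lemma subring1 : A 1. Proof. by case: subA. Qed.
Lemma subringB x y : A x -> A y -> A (x - y). Proof. by case: subA => _ _ h _; apply: h. Qed.
Lemma subringM x y : A x -> A y -> A (x * y). Proof. by case: subA => _ _ _; apply. Qed.
Lemma subringN x : A x -> A (- x).
Proof. by move=> Ax; rewrite -sub0r; apply: subringB => //; apply: subring0. Qed.
Lemma subringD x y : A x -> A y -> A (x + y).
Proof. by move=> Ax Ay; rewrite -[y]opprK; apply: subringB => //; apply: subringN. Qed.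
Lemma subringX x n : A x -> A (x ^+ n).
Proof.
move=> Ax; elim: n => [|n IHn]; first by rewrite expr0; apply: subring1.
by rewrite exprS; apply: subringM.
Qed.
Lemma subring_sum I (r : seq I) (P : pred I) (E : I -> R) :
  (forall i, P i -> A (E i)) -> A (\sum_(i <- r | P i) E i).
Proof. by move=> AE; elim/big_ind: _ => //; [apply: subring0 | apply: subringD]. Qed.

(** A boolean predicate is what the algebraic hierarchy needs in order to make a ring type out of
    [A]; the library notion [integralOver], stated for a ring morphism, then applies to [V]. *)
Definition subring_pred of is_subring A : {pred R} := fun x => `[< A x >].

Lemma subring_predP x : reflect (A x) (x \in subring_pred subA).
Proof. exact: asboolP. Qed.

Lemma subring_pred_closed : subring_closed (subring_pred subA).
Proof.
split=> [|x y /subring_predP Ax /subring_predP Ay|x y /subring_predP Ax /subring_predP Ay];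
  apply/subring_predP; by [apply: subring1 | apply: subringB | apply: subringM].
Qed.

End Subring.

HB.instance Definition _ (R : nzRingType) (A : R -> Prop) (subA : is_subring A) :=
  GRing.isSubringClosed.Build R (subring_pred subA) (subring_pred_closed subA).

Record subring_elt (R : comNzRingType) (A : R -> Prop) (subA : is_subring A) :=
  SubringElt { subring_val : R; _ : subring_val \in subring_pred subA }.

HB.instance Definition _ (R : comNzRingType) (A : R -> Prop) (subA : is_subring A) :=
  [isSub for @subring_val R A subA].
HB.instance Definition _ (R : comNzRingType) (A : R -> Prop) (subA : is_subring A) :=
  [Choice of subring_elt subA by <:].
HB.instance Definition _ (R : comNzRingType) (A : R -> Prop) (subA : is_subring A) :=
  [SubChoice_isSubComNzRing of subring_elt subA by <:].

Section IntegralClosure.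
Variables (F : fieldType) (L : fieldExtType F) (V : F -> Prop).
Hypothesis subV : is_subring V.
Let S := @integral_over F L V.

Let VtoL : {rmorphism subring_elt subV -> L} := in_alg L \o val.

Lemma integral_overP x : S x <-> integralOver VtoL x.
Proof.
split=> [[p [p_mon [pV px]]]|[p p_mon px]].
  have pV' i : p`_i \in subring_pred subV by apply/subring_predP.
  pose q := \poly_(i < size p) (SubringElt (pV' i)).
  have qE : map_poly val q = p.
    apply/polyP => i; rewrite coef_map coef_poly.
    case: ltnP => // lep; by rewrite raddf0 nth_default.
  exists q; last by rewrite map_poly_comp qE.
  apply/monicP/val_inj; rewrite -(lead_coef_map_inj val_inj) ?rmorph0 // qE rmorph1.
  exact/monicP.
exists (map_poly val p); split; [exact: monic_map | split; last by rewrite -map_poly_comp].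
by move=> i; rewrite coef_map; case: (p`_i) => v /= /subring_predP.
Qed.

Lemma integral_over_subring : is_subring S.
Proof.
split.
- by apply/integral_overP; apply: integral0.
- by apply/integral_overP; apply: integral1.
- by move=> x y /integral_overP Sx /integral_overP Sy; apply/integral_overP; apply: integral_sub.
- by move=> x y /integral_overP Sx /integral_overP Sy; apply/integral_overP; apply: integral_mul.
Qed.

Lemma integral_over_alg v : V v -> S v%:A.
Proof.
move=> Vv; have Vv' : v \in subring_pred subV by apply/subring_predP.
by apply/integral_overP; exact: (integral_id VtoL (SubringElt Vv')).
Qed.

Lemma integral_over_trans (p : {poly L}) x :
  p \is monic -> (forall i, S p`_i) -> root p x -> S x.
Proof.
move=> p_mon pS px; apply/integral_overP; apply: integral_root_monic p_mon px _.
by apply/integral_poly => i; apply/integral_overP.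
Qed.

(** Multiplying the relation by the [m]-th power of its leading coefficient [c m.+1] turns it into a
    monic equation for [c m.+1 * x]. *)
Lemma integral_over_leading (c : nat -> L) (x : L) (m : nat) :
  (forall i, S (c i)) -> \sum_(i < m.+2) c i * x ^+ i = 0 -> S (c m.+1 * x).
Proof.
move=> Sc sum0; have subS := integral_over_subring.
pose q := \poly_(i < m.+1) (c i * c m.+1 ^+ (m - i)).
have Sq i : S q`_i.
  rewrite coef_poly; case: ifP => _; last exact: subring0.
  by apply: subringM => //; apply: subringX.
apply: (@integral_over_trans ('X^(m.+1) + q)).
- by rewrite monicE lead_coefDl ?lead_coefXn // size_polyXn ltnS size_poly.
- move=> i; rewrite coefD coefXn; apply: subringD => //.
  by case: (_ == _); [apply: subring1 | apply: subring0].
- rewrite /root hornerD hornerXn horner_poly; apply/eqP.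
  have <- : c m.+1 ^+ m * \sum_(i < m.+2) c i * x ^+ i = (c m.+1 * x) ^+ m.+1 +
      \sum_(i < m.+1) c i * c m.+1 ^+ (m - i) * (c m.+1 * x) ^+ i.
    rewrite big_ord_recr /= mulrDr addrC; congr (_ + _).
      by rewrite exprMn !exprSr; ring.
    rewrite mulr_sumr; apply: eq_bigr => -[i /= lti] _; rewrite exprMn.
    have -> : c m.+1 ^+ m = c m.+1 ^+ (m - i) * c m.+1 ^+ i by rewrite -exprD subnK.
    by ring.
  by rewrite sum0 mulr0.
Qed.

End IntegralClosure.

(** * Maximal ideals and localizations *)

Section MaximalIdeals.
Variables (L : fieldType) (S : L -> Prop).
Hypothesis subS : is_subring S.

Lemma ideal_in_sub I x : is_ideal_in S I -> I x -> S x. Proof. by case=> + _ _ _; apply. Qed.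
Lemma ideal_in0 I : is_ideal_in S I -> I 0. Proof. by case. Qed.
Lemma ideal_inB I x y : is_ideal_in S I -> I x -> I y -> I (x - y).
Proof. by case=> _ _ + _; apply. Qed.
Lemma ideal_inMl I s x : is_ideal_in S I -> S s -> I x -> I (s * x).
Proof. by case=> _ _ _; apply. Qed.
Lemma ideal_inMr I s x : is_ideal_in S I -> S s -> I x -> I (x * s).
Proof. by rewrite mulrC; apply: ideal_inMl. Qed.
Lemma ideal_inN I x : is_ideal_in S I -> I x -> I (- x).
Proof. by move=> idI Ix; rewrite -sub0r; apply: ideal_inB => //; apply: ideal_in0. Qed.
Lemma ideal_inD I x y : is_ideal_in S I -> I x -> I y -> I (x + y).
Proof. by move=> idI Ix Iy; rewrite -[y]opprK; apply: ideal_inB => //; apply: ideal_inN. Qed.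
Lemma ideal_in_sum I (idI : is_ideal_in S I) J (r : seq J) (P : pred J) (E : J -> L) :
  (forall j, P j -> I (E j)) -> I (\sum_(j <- r | P j) E j).
Proof.
by move=> IE; elim/big_ind: _ => // [|x y]; [apply: ideal_in0 | apply: ideal_inD].
Qed.

Lemma principal_ideal x : S x -> is_ideal_in S (fun y => exists2 s, S s & y = s * x).
Proof.
move=> Sx; split.
- by move=> _ [s Ss ->]; apply: subringM.
- by exists 0; rewrite ?mul0r //; apply: subring0.
- by move=> _ _ [s Ss ->] [t St ->]; exists (s - t); rewrite ?mulrBl //; apply: subringB.
- by move=> t _ St [s Ss ->]; exists (t * s); rewrite ?mulrA //; apply: subringM.
Qed.

Lemma maximal_ideal_exists I : is_ideal_in S I -> ~ I 1 ->
  exists2 M, maximal_ideal_in S M & forall x, I x -> M x.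
Proof.
move=> idI I1.
pose P (X : set L) := X = set0 \/ [/\ is_ideal_in S X, ~ X 1 & I `<=` X]%classic.
have [A [PA Amax]] : exists A, P A /\ forall B, (A `<` B)%classic -> ~ P B.
  apply: Zorn_bigcup => C CP Ctot.
  have CP' X x : C X -> X x -> [/\ is_ideal_in S X, ~ X 1 & I `<=` X]%classic.
    by move=> CX Xx; case: (CP _ CX) => // X0; rewrite X0 in Xx.
  have [[X0 CX0 [x0 X0x0]]|noX] := pselect (exists2 X, C X & exists x, X x); last first.
    by left; apply/seteqP; split=> // x [X CX Xx]; apply: noX; exists X => //; exists x.
  right; have [idX0 _ IX0] := CP' _ _ CX0 X0x0; split.
  - split.
    + by move=> x [X CX Xx]; have [idX _ _] := CP' _ _ CX Xx; apply: ideal_in_sub idX Xx.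
    + by exists X0 => //; apply: ideal_in0.
    + move=> x y [X CX Xx] [Y CY Yy].
      have [idX _ _] := CP' _ _ CX Xx; have [idY _ _] := CP' _ _ CY Yy.
      have [XY|YX] := Ctot _ _ CX CY.
        by exists Y => //; apply: ideal_inB => //; apply: XY.
      by exists X => //; apply: ideal_inB => //; apply: YX.
    + move=> s x Ss [X CX Xx]; have [idX _ _] := CP' _ _ CX Xx.
      by exists X => //; apply: ideal_inMl.
  - by move=> [X CX X1]; have [_ + _] := CP' _ _ CX X1; apply.
  - by move=> x Ix; exists X0 => //; apply: IX0.
case: PA => [A0|[idA A1 IA]].
  exfalso; apply: (Amax I); last by right; split.
  rewrite A0; split=> // /(_ 0); apply; exact: ideal_in0.
exists A => //; split=> // N idN AN N1 x; split; last exact: AN.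
move=> Nx; apply: contrapT => Ax; apply: (Amax N).
  by split=> // /(_ _ Nx).
by right; split=> // y /IA /AN.
Qed.

Section OneMaximalIdeal.
Variable M : L -> Prop.
Hypothesis maxM : maximal_ideal_in S M.

Let idM : is_ideal_in S M. Proof. by case: maxM. Qed.

(** The ideal [M + S d] strictly contains [M], hence contains 1. *)
Lemma maximal_ideal_comax d : S d -> ~ M d -> exists a, S a /\ M (1 - a * d).
Proof.
move=> Sd Md; have [_ M1 Mmax] := maxM.
pose N x := exists a, S a /\ M (x - a * d).
have S1 := subring1 subS; have S0 := subring0 subS.
have idN : is_ideal_in S N.
  split.
  - move=> x [a [Sa Mx]]; rewrite -[x](subrK (a * d)); apply: subringD => //.
      exact: ideal_in_sub Mx.
    exact: subringM.
  - by exists 0; split=> //; rewrite mul0r subr0; apply: ideal_in0.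
  - move=> x y [a [Sa Mx]] [b [Sb My]]; exists (a - b); split; first exact: subringB.
    have -> : x - y - (a - b) * d = (x - a * d) - (y - b * d) by ring.
    exact: ideal_inB.
  - move=> s x Ss [a [Sa Mx]]; exists (s * a); split; first exact: subringM.
    by rewrite -mulrA -mulrBr; apply: ideal_inMl.
have [//|N1] := pselect (N 1).
have MN x : M x -> N x by move=> Mx; exists 0; split=> //; rewrite mul0r subr0.
exfalso; apply: Md; apply/(Mmax _ idN MN N1); exists 1; split=> //.
by rewrite mul1r subrr; apply: ideal_in0.
Qed.

Lemma maximal_ideal_prime x y : S x -> S y -> M (x * y) -> ~ M x -> M y.
Proof.
move=> Sx Sy Mxy Mx; have [a [Sa Ma]] := maximal_ideal_comax Sx Mx.
have -> : y = (1 - a * x) * y + a * (x * y) by ring.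
by apply: ideal_inD => //; [apply: ideal_inMr | apply: ideal_inMl].
Qed.

Lemma maximal_ideal_nmul x y : S x -> S y -> ~ M x -> ~ M y -> ~ M (x * y).
Proof. by move=> Sx Sy Mx My /maximal_ideal_prime; auto. Qed.

Lemma maximal_ideal_nX x n : S x -> ~ M x -> ~ M (x ^+ n).
Proof.
move=> Sx Mx; elim: n => [|n IHn]; first by rewrite expr0; case: maxM.
by rewrite exprS; apply: maximal_ideal_nmul => //; apply: subringX.
Qed.

Lemma maximal_ideal_nunit u : u != 0 -> S u^-1 -> ~ M u.
Proof.
by move=> u0 Su Mu; have [_ + _] := maxM; apply; rewrite -(mulVf u0); apply: ideal_inMl.
Qed.

Lemma ideal_sq_sub x : ideal_sq M x -> M x.
Proof.
case=> s [sM ->]; rewrite big_seq; apply: ideal_in_sum => // -[a b] /sM [Ma Mb] /=.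
by apply: ideal_inMl => //; apply: ideal_in_sub Ma.
Qed.

Lemma ideal_sqMl s x : S s -> ideal_sq M x -> ideal_sq M (s * x).
Proof.
move=> Ss [r [rM ->]]; exists [seq (s * ab.1, ab.2) | ab <- r]; split.
  by move=> _ /mapP[ab /rM[Ma Mb] ->] /=; split=> //; apply: ideal_inMl.
by rewrite big_map mulr_sumr; apply: eq_bigr => ab _; rewrite mulrA.
Qed.

Lemma ideal_sqMM x y : M x -> M y -> ideal_sq M (x * y).
Proof.
move=> Mx My; exists [:: (x, y)]; rewrite big_seq1; split=> //.
by move=> ab; rewrite inE => /eqP ->.
Qed.

Lemma ideal_sqD x y : ideal_sq M x -> ideal_sq M y -> ideal_sq M (x + y).
Proof.
move=> [r [rM ->]] [r' [rM' ->]]; exists (r ++ r'); rewrite big_cat; split=> //.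
by move=> ab; rewrite mem_cat => /orP[/rM|/rM'].
Qed.

(** This is the fact that [M^2] is [M]-primary: [d] has an inverse [a] modulo [M], primality gives
    [h] in [M], and both terms of [(1 - a d) h + a (d h)] lie in [M^2]. *)
Lemma ideal_sq_cancel d h : S d -> S h -> ~ M d -> ideal_sq M (d * h) -> ideal_sq M h.
Proof.
move=> Sd Sh Md M2dh; have [a [Sa Ma]] := maximal_ideal_comax Sd Md.
have Mh : M h by apply: maximal_ideal_prime (ideal_sq_sub M2dh) Md.
have -> : h = (1 - a * d) * h + a * (d * h) by ring.
by apply: ideal_sqD; [apply: ideal_sqMM | apply: ideal_sqMl].
Qed.

End OneMaximalIdeal.

(** Membership in the localization of [S] at [M], viewed as a subring of [L]. *)
Definition localized (M : L -> Prop) (x : L) : Prop :=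
  exists d, [/\ S d, ~ M d & S (d * x)].

Definition jacobson_ideal (x : L) : Prop :=
  S x /\ forall M, maximal_ideal_in S M -> M x.

(** The denominators of [x] form an ideal of [S]; by hypothesis no maximal ideal contains it, so 1
    is a denominator. *)
Lemma localized_all x : (forall M, maximal_ideal_in S M -> localized M x) -> S x.
Proof.
move=> locx; have S1 := subring1 subS.
pose I d := S d /\ S (d * x).
have idI : is_ideal_in S I.
  split.
  - by move=> d [].
  - by split; rewrite ?mul0r; apply: subring0.
  - by move=> d e [? ?] [? ?]; split; rewrite ?mulrBl; apply: subringB.
  - by move=> s d Ss [? ?]; split; rewrite -?mulrA; apply: subringM.
have [[_ ]|I1] := pselect (I 1); first by rewrite mul1r.
have [M maxM IM] := maximal_ideal_exists idI I1.
by have [d [Sd Md Sdx]] := locx M maxM; case: Md; apply: IM.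
Qed.

Lemma jacobson_unit x : jacobson_ideal x -> 1 - x != 0 /\ S (1 - x)^-1.
Proof.
move=> [Sx Jx]; have S1 := subring1 subS.
have Su : S (1 - x) by apply: subringB.
have idI := principal_ideal Su.
have noM M : maximal_ideal_in S M -> ~ M (1 - x).
  move=> maxM Mu; have [idM + _] := maxM; apply.
  by rewrite -(subrK x 1); apply: ideal_inD => //; apply: Jx.
have [[s Ss E]|I1] := pselect (exists2 s, S s & 1 = s * (1 - x)); last first.
  have [M maxM IM] := maximal_ideal_exists idI I1.
  by exfalso; apply: (noM M) => //; apply: IM; exists 1; rewrite ?mul1r.
have u0 : 1 - x != 0.
  by apply/eqP => u0; move/eqP: E; rewrite u0 mulr0 oner_eq0.
by have -> : (1 - x)^-1 = s; first apply: (mulIf u0); rewrite ?mulVf.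
Qed.

Lemma jacobson_ideal_ideal : is_ideal_in S jacobson_ideal.
Proof.
split.
- by move=> x [].
- by split=> [|M [idM _ _]]; [apply: subring0 | apply: ideal_in0].
- move=> x y [Sx Jx] [Sy Jy]; split=> [|M maxM]; first exact: subringB.
  by have [idM _ _] := maxM; apply: ideal_inB; [exact: idM | apply: Jx | apply: Jy].
- move=> s x Ss [Sx Jx]; split=> [|M maxM]; first exact: subringM.
  by have [idM _ _] := maxM; apply: ideal_inMl; [exact: idM | | apply: Jx].
Qed.

End MaximalIdeals.

(** * Integral closures of valuation rings with principal radical *)

Section ValuationRing.
Variables (F : fieldType) (L : fieldExtType F) (V : F -> Prop) (p : F).
Hypothesis valV : valuation_ring V.
Hypothesis Vp : V p.
Hypothesis radV : forall x, jacobson_val V x <-> exists v, V v /\ x = v * p.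

Let subV : is_subring V. Proof. by case: valV. Qed.
Let S := @integral_over F L V.
Let subS : is_subring S. Proof. exact: integral_over_subring. Qed.
Let SV v : V v -> S v%:A. Proof. exact: integral_over_alg. Qed.

Lemma valuation_ring_cases a : V a ->
  (exists v, V v /\ a = v * p) \/ (a != 0 /\ V a^-1).
Proof.
move=> Va; have [VaV|] := pselect (V a^-1); last by move=> ?; left; apply/radV; split; auto.
have [->|a0] := eqVneq a 0; last by right.
by left; exists 0; rewrite mul0r; split=> //; apply: subring0.
Qed.

Lemma uniformizer_nunit v : V v -> 1 <> v * p.
Proof.
move=> Vv E; have [_ []] : jacobson_val V 1 by apply/radV; exists v.
  by apply/eqP; rewrite oner_eq0.
by rewrite invr1; apply; apply: subring1.
Qed.

(** Divisibility by elements of [V] is total on [F], so an entry of least valuation can be found by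
    comparing each new entry with the best one so far. *)
Lemma valuation_ring_dominant n (c : nat -> F) : (exists2 i, (i <= n)%N & c i != 0) ->
  exists i0, [/\ (i0 <= n)%N, c i0 != 0 & forall i, (i <= n)%N -> V (c i / c i0)].
Proof.
have V1 := subring1 subV.
elim: n => [|n IHn] [i lein ci].
  move: lein ci; rewrite leqn0 => /eqP-> c0; exists 0; split=> // j.
  by rewrite leqn0 => /eqP->; rewrite divff.
have [cn0|cn] := eqVneq (c n.+1) 0.
  have [|i0 [le0 c0 max0]] := IHn.
    by exists i => //; move: lein; rewrite leq_eqVlt => /predU1P[iE|//]; rewrite iE cn0 eqxx in ci.
  exists i0; split=> //; first exact: leqW.
  move=> j; rewrite leq_eqVlt => /predU1P[->|]; last exact: max0.
  by rewrite cn0 mul0r; apply: subring0.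
have [small|small] := pselect (exists2 i, (i <= n)%N & c i != 0); last first.
  exists n.+1; split=> // j; rewrite leq_eqVlt => /predU1P[->|lejn]; first by rewrite divff.
  suff -> : c j = 0 by rewrite mul0r; apply: subring0.
  by apply/eqP; apply: contrapT => /negP cj; apply: small; exists j.
have [i0 [le0 c0 max0]] := IHn small.
have r0 : c n.+1 / c i0 != 0 by rewrite mulf_neq0 ?invr_eq0.
have [Vr|] := (proj2 valV) _ r0.
  exists i0; split=> //; first exact: leqW.
  by move=> j; rewrite leq_eqVlt => /predU1P[->|/max0].
rewrite invf_div => Vr; exists n.+1; split=> // j.
rewrite leq_eqVlt => /predU1P[->|lejn]; first by rewrite divff.
have -> : c j / c n.+1 = (c j / c i0) * (c i0 / c n.+1) by rewrite mulrA divfK.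
by apply: subringM => //; apply: max0.
Qed.

Let n := \dim {:L}.

(** More than [n] elements of an [n]-dimensional space are dependent; dividing a relation by a
    coefficient of least valuation puts all coefficients in [V] and makes one of them 1. *)
Lemma primitive_relation (x : nat -> L) : exists a : nat -> F,
  [/\ forall i, V (a i), exists2 i, (i <= n)%N & a i = 1 &
      \sum_(i < n.+1) (a i)%:A * x i = 0].
Proof.
pose X := [tuple x i | i < n.+1].
have : ~~ free X.
  by rewrite /free size_tuple neq_ltn ltnS dimvS ?subvf.
move/freeP/boolp.existsNP => -[k /boolp.not_implyP[ksum /boolp.existsNP[i0 ki0]]].
pose c j := if insub j is Some i then k i else 0 : F.
have cE (i : 'I_n.+1) : c i = k i by rewrite /c valK.
have [|i1 [le1 c1 max1]] := @valuation_ring_dominant n c.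
  by exists i0; rewrite -1?ltnS // cE; apply/eqP.
exists (fun i => if (i <= n)%N then c i / c i1 else 0); split.
- by move=> i; case: ifP => [/max1//|_]; apply: subring0.
- by exists i1; rewrite // le1 divff.
- rewrite -[RHS](scaler0 _ (c i1)^-1) -[in RHS]ksum scaler_sumr; apply: eq_bigr => i _.
  by rewrite -ltnS ltn_ord cE (nth_mktuple _ _ i) mulr_algl scalerA mulrC.
Qed.

(** Here [i] is the first index whose coefficient is a unit of [V]. Terms before [i] are then
    divisible by [p], while for a sequence in which each element divides the next, terms after [i]
    are divisible by [x i.+1]. *)
Lemma primitive_relation_min (x : nat -> L) : exists (a : nat -> F) (i : nat),
  [/\ forall j, V (a j), ~ (exists v, V v /\ a i = v * p),
      forall j, (j < i)%N -> exists v, V v /\ a j = v * p &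
      (a i)%:A * x i = - \sum_(j < n.+1 | j != i :> nat) (a j)%:A * x j].
Proof.
have [a [aV [i1 le1 a1] sum0]] := primitive_relation x.
have ex : exists i, (i <= n)%N && ~~ `[< exists v, V v /\ a i = v * p >].
  exists i1; rewrite le1; apply/asboolPn => -[v [Vv]]; rewrite a1; exact: uniformizer_nunit.
have [i /andP[lein /asboolPn ai] imin] := ex_minnP ex.
have ltin : (i < n.+1)%N by rewrite ltnS.
exists a, i; split=> //.
  move=> j ltji; apply: contrapT => naj; have : (i <= j)%N; last by rewrite leqNgt ltji.
  by apply: imin; rewrite (leq_trans (ltnW ltji)) //; apply/asboolPn.
by apply/eqP; rewrite -addr_eq0; move: sum0; rewrite (bigD1 (Ordinal ltin)) //= => ->.
Qed.

(** The degenerate case: a zero radical forces [V = F], and minimal polynomials witness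
    integrality. *)
Lemma integral_over_trivial : p = 0 -> forall x, S x.
Proof.
move=> p0.
have VT a : V a.
  have [->|a0] := eqVneq a 0; first exact: subring0.
  have [//|VaV] := (proj2 valV) _ a0.
  have [[v [_ E]]|[_]] := valuation_ring_cases VaV; last by rewrite invrK.
  by move/eqP: E; rewrite p0 mulr0 invr_eq0 (negPf a0).
move=> x; have /polyOver1P[q qE] := minPolyOver 1%AS x.
exists q; split; last by rewrite -qE root_minPoly.
by rewrite -(map_monic (in_alg L)) -qE monic_minPoly.
Qed.

Section LocalAnalysis.
Variable M : L -> Prop.
Hypothesis maxM : maximal_ideal_in S M.
Let idM : is_ideal_in S M. Proof. by case: maxM. Qed.

(** Otherwise [p s] is 1 modulo [M] for some [s]. Multiplying a monic equation of [s] of degree [d]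
    by [p ^+ d] and reducing modulo [M] puts some [1 + p r] with [r] in [V] into [M], but this is a
    unit of [V]. *)
Lemma uniformizer_maximal : M p%:A.
Proof.
apply: contrapT => Mp.
have [s [Ss Mps]] := maximal_ideal_comax subS maxM (SV Vp) Mp.
have [q [q_mon [qV /rootP qs]]] := Ss.
have Mpow i : M (1 - (p%:A * s) ^+ i).
  elim: i => [|i IHi]; first by rewrite expr0 subrr; apply: ideal_in0 idM.
  have -> : 1 - (p%:A * s) ^+ i.+1 =
      (1 - (p%:A * s) ^+ i) + (p%:A * s) ^+ i * (1 - s * p%:A) by rewrite exprSr; ring.
  apply: (ideal_inD idM) => //; apply: (ideal_inMl idM) => //.
  by apply: subringX => //; apply: subringM => //; apply: SV.
set d := (size q).-1; pose r := \sum_(i < d) q`_i * p ^+ (d - i.+1).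
have sz : size q = d.+1 by rewrite prednK // size_poly_gt0 monic_neq0.
have Vr : V r by apply: subring_sum => // i _; apply: subringM => //; apply: subringX.
have M1 : M (1 + p * r)%:A.
  have sum0 : \sum_(i < d.+1) (q`_i * p ^+ (d - i))%:A * (p%:A * s) ^+ i = 0.
    rewrite -[RHS](mulr0 (p ^+ d)%:A) -[in RHS]qs horner_coef size_map_poly sz mulr_sumr.
    apply: eq_bigr => i _; rewrite coef_map /= exprMn -!in_algE -!rmorphXn /=.
    have -> : p ^+ d = p ^+ (d - i) * p ^+ i by rewrite -exprD subnK // -ltnS.
    by rewrite -!in_algE !rmorphM; ring.
  have -> : (1 + p * r)%:A = \sum_(i < d.+1) (q`_i * p ^+ (d - i))%:A * (1 - (p%:A * s) ^+ i).
    under eq_bigr do rewrite mulrBr mulr1.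
    rewrite sumrB sum0 subr0 -scaler_suml; congr (_ *: _).
    rewrite big_ord_recr /= subnn expr0 mulr1 (monicP q_mon : q`_d = 1) addrC.
    congr (_ + _); rewrite mulr_sumr; apply: eq_bigr => i _.
    by rewrite mulrCA -exprS -subSn.
  apply: (ideal_in_sum idM) => // i _; apply: (ideal_inMl idM) => //.
  by apply: SV; apply: subringM => //; apply: subringX.
have Vu : V (1 + p * r) by apply: subringD; rewrite //; [apply: subring1 | apply: subringM].
have [[v [Vv E]]|[u0 VuV]] := valuation_ring_cases Vu.
  apply: (@uniformizer_nunit (v - r)); first exact: subringB.
  by rewrite mulrBl -E; ring.
move: M1; apply: (maximal_ideal_nunit maxM); first by rewrite -in_algE fmorph_eq0.
by rewrite -in_algE -fmorphV; apply: SV.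
Qed.

Lemma valuation_ring_notin_maximal a : V a -> ~ (exists v, V v /\ a = v * p) -> ~ M a%:A.
Proof.
move=> Va; have [//|[a0 VaV] _] := valuation_ring_cases Va.
apply: (maximal_ideal_nunit maxM); first by rewrite -in_algE fmorph_eq0.
by rewrite -in_algE -fmorphV; apply: SV.
Qed.

Lemma localized_total x : x != 0 -> localized S M x \/ localized S M x^-1.
Proof.
move=> x0; have [a [aV [i1 le1 a1] sum0]] := primitive_relation (fun i => x ^+ i).
(* Both b_k and x b_k are integral for b_k = a_{n-k+1} + a_{n-k+2} x + ... + a_n x^(k-1), and
   they cannot all lie in M because some coefficient a_{n-k} = b_{k+1} - x b_k is 1. *)
pose b := fix b k := if k is j.+1 then (a (n - j)%N)%:A + x * b j else 0 : L.
have bsum k i : (i + k = n.+1)%N -> b k * x ^+ i + \sum_(j < i) (a j)%:A * x ^+ j = 0.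
  elim: k i => [|k IHk] i; first by rewrite addn0 mul0r add0r => ->.
  rewrite addnS -addSn => ik; apply: etrans (IHk _ ik); rewrite big_ord_recr /= exprS.
  have -> : (n - k)%N = i by case: ik => <-; rewrite addnK.
  by ring.
(* Collapsing the top terms of the relation into [b k * x ^+ i.+1] makes [b k] the leading
   coefficient of a relation for [x] with integral coefficients. *)
have Sxb k i : (i.+1 + k = n.+1)%N -> S (b k) -> S (x * b k).
  move=> ik Sb; pose c j := if j == i.+1 then b k else (a j)%:A.
  have := @integral_over_leading F L V subV c x i; rewrite {3}/c eqxx mulrC; apply.
    by move=> j; rewrite /c; case: ifP => // _; apply: SV.
  apply: etrans (bsum _ _ ik); rewrite big_ord_recr /= {2}/c eqxx addrC; congr (_ + _).
  by apply: eq_bigr => j _; rewrite /c ltn_eqF.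
have Sb k i : (i + k = n.+1)%N -> S (b k).
  elim: k i => [|k IHk] i /=; first by move=> _; apply: subring0.
  rewrite addnS -addSn => ik; apply: subringD => //; first exact: SV.
  by apply: (Sxb _ _ ik); apply: (IHk _ ik).
have bn : b n.+1 = 0 by have := bsum n.+1 0%N erefl; rewrite expr0 mulr1 big_ord0 addr0.
apply: contrapT => /boolp.not_orP[nx nxV].
(* Outside [M], the element [x * b k] would be a denominator of [x^-1]; likewise, below, [b k] would
   be one of [x]. *)
have Mxb k i : (i.+1 + k = n.+1)%N -> M (x * b k).
  move=> ik; apply: contrapT => Mxb; apply: nxV; exists (x * b k); split=> //.
    by apply: (Sxb _ _ ik); apply: (Sb _ _ ik).
  by rewrite mulrAC divff // mul1r; apply: (Sb _ _ ik).
have Mb k i : (i + k = n.+1)%N -> M (b k).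
  case: i => [|i] ik; first by rewrite -[k]add0n ik bn; apply: ideal_in0 idM.
  apply: contrapT => Mb; apply: nx; exists (b k); split=> //; first exact: (Sb _ _ ik).
  by rewrite mulrC; apply: (Sxb _ _ ik); apply: (Sb _ _ ik).
have i1E : (i1.+1 + (n - i1) = n.+1)%N by rewrite addSn subnKC.
have [_ + _] := maxM; apply.
have -> : 1 = b (n - i1).+1 - x * b (n - i1)%N.
  by rewrite /= subKn // a1 scale1r addrK.
apply: (ideal_inB idM); last exact: (Mxb _ _ i1E).
by apply: (Mb _ i1); rewrite addnS -addSn.
Qed.

(** In the valuation ring [S_M], the inverse of an element outside it lies in the maximal ideal;
    here that inverse is written [m / d]. *)
Lemma localized_inv x : x != 0 -> ~ localized S M x ->
  exists d m, [/\ S d, ~ M d, M m & x * m = d].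
Proof.
move=> x0 nx; have [//|[d [Sd Md Sdx]]] := localized_total x0.
exists d, (d * x^-1); split=> //; last by rewrite mulrC divfK.
apply: contrapT => Mm; apply: nx; exists (d * x^-1); split=> //.
by rewrite divfK.
Qed.

End LocalAnalysis.

(** The check is local: if [j / h] is not in [S_M], then [d h = j m] with [d] outside [M] and [m] in
    [M]. Hence [d h], and so [h], lies in [M^2]. *)
Lemma jacobson_ideal_dvd j h : jacobson_ideal S j -> S h -> h != 0 ->
  (forall M, maximal_ideal_in S M -> ~ ideal_sq M h) -> S (j / h).
Proof.
move=> [Sj Jj] Sh h0 Mh; have [->|j0] := eqVneq j 0.
  by rewrite mul0r; apply: subring0.
apply: (localized_all subS) => M maxM; apply: contrapT => nloc.
have jh0 : j / h != 0 by rewrite mulf_neq0 ?invr_eq0.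
have [d [m [Sd Md Mm E]]] := localized_inv maxM jh0 nloc.
apply: (Mh M maxM); apply: (ideal_sq_cancel subS maxM Sd Sh Md).
have -> : d * h = j * m by rewrite -E mulrAC divfK.
by apply: ideal_sqMM => //; apply: Jj.
Qed.

(** If [k] is not in [S_M], write [k m = d] with [m] in [M] and [d] outside [M]. Every [k ^+ i * p]
    lies in [S], as [p] is in [J(S)]. Multiply a relation between the powers of [m] by
    [d ^+ i.+1 = k ^+ i.+1 * m ^+ i.+1], where [i] is the first unit index: all other terms become
    multiples of [m ^+ i.+1]. Cancelling [m ^+ i] puts [d ^+ i.+1] times a unit into [M], which is
    absurd. *)
Lemma jacobson_ideal_stabilizer k :
  (forall j, jacobson_ideal S j -> jacobson_ideal S (k * j)) -> S k.
Proof.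
move=> kJ; have [p0|p0] := eqVneq p 0; first exact: integral_over_trivial.
have [->|k0] := eqVneq k 0; first exact: subring0.
apply: (localized_all subS) => M maxM; apply: contrapT => nloc.
have [d [m [Sd Md Mm E]]] := localized_inv maxM k0 nloc.
have idM : is_ideal_in S M by case: maxM.
have Sm := ideal_in_sub idM Mm.
have m0 : m != 0 by apply: contra_notN Md => /eqP m0; rewrite -E m0 mulr0; apply: ideal_in0 idM.
have Jp i : S (k ^+ i * p%:A).
  have [] // : jacobson_ideal S (k ^+ i * p%:A).
  elim: i => [|i IHi]; last by rewrite exprS -mulrA; apply: kJ.
  rewrite expr0 mul1r; split=> [|N maxN]; first exact: SV.
  exact: uniformizer_maximal.
have [a [i [aV ai aj rel]]] := primitive_relation_min (fun i => m ^+ i).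
have Mai := valuation_ring_notin_maximal maxM (aV i) ai.
have : M (d ^+ i.+1 * (a i)%:A); last first.
  apply: (maximal_ideal_nmul subS maxM) => //; [by apply: subringX | exact: SV |].
  by apply: (maximal_ideal_nX subS maxM).
have term (j : 'I_n.+1) : j != i :> nat -> exists s, S s /\
    d ^+ i.+1 * ((a j)%:A * m ^+ j) = s * m ^+ i.+1.
  rewrite neq_ltn => /orP[ltji|ltij]; last first.
    exists (d ^+ i.+1 * (a j)%:A * m ^+ (j - i.+1)); split.
      apply: subringM => //; last exact: subringX.
      by apply: subringM => //; [apply: subringX | apply: SV].
    have -> : m ^+ j = m ^+ (j - i.+1) * m ^+ i.+1 by rewrite -exprD subnK.
    by rewrite !mulrA.
  have [v [Vv av]] := aj j ltji.
  exists (v%:A * (k ^+ i.+1 * p%:A) * m ^+ j); split.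
    apply: subringM => //; last exact: subringX.
    by apply: subringM => //; apply: SV.
  rewrite av -E exprMn -!in_algE rmorphM /=; ring.
have [s [Ss sE]] : exists s, S s /\
    d ^+ i.+1 * (\sum_(j < n.+1 | j != i :> nat) (a j)%:A * m ^+ j) = s * m ^+ i.+1.
  rewrite mulr_sumr; elim/big_rec: _ => [|j x ji [s [Ss ->]]].
    by exists 0; rewrite mul0r; split=> //; apply: subring0.
  have [t [St ->]] := term j ji; exists (t + s); rewrite mulrDl; split=> //.
  exact: subringD.
have -> : d ^+ i.+1 * (a i)%:A = - s * m.
  apply: (mulIf (expf_neq0 i m0)); rewrite -!mulrA -exprS rel mulrN sE mulNr //.
by apply: (ideal_inMl idM) => //; apply: subringN.
Qed.

Lemma maximal_ideal_inverse M : p != 0 -> maximal_ideal_in S M ->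
  exists2 k, ~ S k & forall m, M m -> S (k * m).
Proof.
move=> p0 maxM; have idM : is_ideal_in S M by case: maxM.
have P0 : p%:A != 0 :> L by rewrite -in_algE fmorph_eq0.
have SP : S p%:A by apply: SV.
have S1 := subring1 subS; have SM m : M m -> S m by apply: ideal_in_sub.
pose pS x := exists2 s, S s & x = s * p%:A.
have pSM s x : S s -> pS x -> pS (s * x).
  by move=> Ss [t St ->]; exists (s * t); rewrite ?mulrA //; apply: subringM.
(* [Q q] says that the class of [q] in [S / pS] stays nonzero after localization at [M]. The element
   sought is [k = q / p], with such a [q] killed by [M] modulo [p]. *)
pose Q q := S q /\ forall d, S d -> ~ M d -> ~ pS (d * q).
suff [q [Sq Qq] qM] : exists2 q, Q q & forall m, M m -> pS (q * m).
  exists (q / p%:A) => [Sk|m /qM[s Ss E]].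
    have [_ M1 _] := maxM; apply: (Qq 1) => //; rewrite mul1r.
    by exists (q / p%:A); rewrite ?divfK.
  by rewrite mulrAC E mulfK.
apply: contrapT => noq.
have noq' q : Q q -> exists2 m, M m & ~ pS (q * m).
  move=> Qq; apply: contrapT => nom; apply: noq; exists q => // m Mm.
  by apply: contrapT => nqm; apply: nom; exists m.
(* The ideals q S + p S can be made to decrease strictly, but such chains have bounded length. *)
have step q : exists c, Q q -> [/\ S c, Q (q * c) &
    ~ exists s t, [/\ S s, S t & q = s * (q * c) + t * p%:A]].
  have [Qq|] := pselect (Q q); last by exists 0.
  have [m Mm nqm] := noq' q Qq; have Sm := SM m Mm; have [Sq Qq'] := Qq.
  (* If [Q (q * m)] holds, multiply by [m]: a return to [q] would give [(1 - s m) q] in [pS] with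
     [1 - s m] outside [M]. Otherwise some [d] outside [M] kills [q m] modulo [p]; multiply by [d]:
     a return to [q] would put [q m] in [pS]. *)
  have [Qqm|nQqm] := pselect (Q (q * m)).
    exists m => _; split=> // -[s [t [Ss St E]]].
    apply: (Qq' (1 - s * m)); first by apply: subringB => //; apply: subringM.
      have [_ + _] := maxM; apply: contra_not => M1.
      rewrite -(subrK (s * m) 1); apply: (ideal_inD idM) => //.
      exact: (ideal_inMl idM).
    by exists t => //; rewrite mulrBl mul1r {1}E; ring.
  have [d [Sd Md dqm]] : exists d, [/\ S d, ~ M d & pS (d * (q * m))].
    apply: contrapT => nod; apply: nQqm; split=> [|d Sd Md dqm].
      exact: subringM.
    by apply: nod; exists d.
  exists d => _; split=> //.
    split=> [|e Se Me]; first exact: subringM.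
    rewrite (mulrC q) mulrA; apply: Qq'; first exact: subringM.
    exact: (maximal_ideal_nmul subS maxM).
  move=> [s [t [Ss St E]]]; apply: nqm.
  have [u Su uE] := dqm; exists (s * u + t * m).
    by apply: subringD => //; apply: subringM.
  have -> : q * m = s * (d * (q * m)) + t * p%:A * m by rewrite {1}E; ring.
  by rewrite uE; ring.
have [g gP] := boolp.choice step.
pose x := fix x i := if i is j.+1 then x j * g (x j) else 1 : L.
have Qx i : Q (x i).
  elim: i => [|i IHi]; last by have [] := gP _ IHi.
  split=> // d Sd Md [s Ss]; rewrite /= mulr1 => dE; apply: Md; rewrite dE.
  by apply: (ideal_inMl idM) => //; apply: uniformizer_maximal.
have Sx i : S (x i) by case: (Qx i).
have x_dvd i j : (i <= j)%N -> exists2 s, S s & x j = s * x i.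
  elim: j => [|j IHj]; first by rewrite leqn0 => /eqP->; exists 1; rewrite ?mul1r.
  rewrite leq_eqVlt => /predU1P[->|/IHj[s Ss E]]; first by exists 1; rewrite ?mul1r.
  exists (s * g (x j)); last by rewrite /= E; ring.
  by apply: subringM => //; have [] := gP _ (Qx j).
(* Since [a i] is a unit of [V], the relation puts [x i] into [S x_{i+1} + pS], against the strict
   decrease. *)
have [a [i [aV ai aj rel]]] := primitive_relation_min x.
have term (j : 'I_n.+1) : j != i :> nat -> exists s t,
    [/\ S s, S t & (a j)%:A * x j = s * x i.+1 + t * p%:A].
  rewrite neq_ltn => /orP[ltji|ltij].
    have [v [Vv av]] := aj j ltji; exists 0, (v%:A * x j); split.
    - exact: subring0.
    - by apply: subringM => //; apply: SV.
    - by rewrite av -!in_algE rmorphM; ring.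
  have [s Ss E] := x_dvd _ _ ltij; exists ((a j)%:A * s), 0; split.
  - by apply: subringM => //; apply: SV.
  - exact: subring0.
  - by rewrite E; ring.
have [s [t [Ss St stE]]] : exists s t, [/\ S s, S t &
    \sum_(j < n.+1 | j != i :> nat) (a j)%:A * x j = s * x i.+1 + t * p%:A].
  elim/big_rec: _ => [|j y ji [s [t [Ss St ->]]]].
    by exists 0, 0; split; rewrite ?mul0r ?addr0 //; apply: subring0.
  have [s' [t' [Ss' St' ->]]] := term j ji; exists (s' + s), (t' + t).
  by split; [apply: subringD | apply: subringD | ring].
have [//|[ai0 VaiV]] := valuation_ring_cases (aV i).
have [_ _] := gP _ (Qx i); apply; pose b := (a i)^-1; exists (- b%:A * s), (- b%:A * t).
have Sb : S (- b%:A) by apply: subringN => //; apply: SV.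
split; [exact: subringM | exact: subringM |].
have {1}-> : x i = b%:A * ((a i)%:A * x i).
  by rewrite mulrA -!in_algE -rmorphM mulVf // rmorph1 mul1r.
by rewrite rel stE /=; ring.
Qed.

End ValuationRing.

(** * Galois action and cocycles *)

Section GaloisAction.
Variables (F : fieldType) (L : splittingFieldType F).
Implicit Types s t r : gal_of {: L}.

Lemma gcompE s t a : gcomp s t a = s (t a). Proof. by rewrite galM ?memvf. Qed.
Lemma gal1E a : (1%g : gal_of {: L}) a = a. Proof. by rewrite gal_id. Qed.
Lemma galVKE s : cancel s^-1%g s.
Proof. by move=> a; rewrite -galM ?memvf // mulVg gal_id. Qed.
Lemma galKVE s : cancel s s^-1%g.
Proof. by move=> a; rewrite -galM ?memvf // mulgV gal_id. Qed.

Lemma gcompA s t r : gcomp s (gcomp t r) = gcomp (gcomp s t) r.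
Proof. by rewrite /gcomp mulgA. Qed.
Lemma gcomp1s s : gcomp 1%g s = s. Proof. by rewrite /gcomp mulg1. Qed.
Lemma gcomps1 s : gcomp s 1%g = s. Proof. by rewrite /gcomp mul1g. Qed.
Lemma gcompV s : gcomp s s^-1%g = 1%g. Proof. by rewrite /gcomp mulVg. Qed.
Lemma gcompVs s : gcomp s^-1%g s = 1%g. Proof. by rewrite /gcomp mulgV. Qed.
Lemma gcompKV s t : gcomp s (gcomp s^-1%g t) = t.
Proof. by rewrite gcompA gcompV gcomp1s. Qed.

Lemma integral_over_gal (V : F -> Prop) s x : integral_over V x -> integral_over V (s x).
Proof.
case=> q [q_mon [qV /rootP qx]]; exists q; split=> //; split=> //.
have -> : map_poly (in_alg L) q = map_poly s (map_poly (in_alg L) q).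
  by rewrite -map_poly_comp; apply: eq_map_poly => a /=; rewrite linearZ /= rmorph1.
by rewrite /root horner_map qx rmorph0.
Qed.

Section Cocycle.
Variable f : gal_of {: L} -> gal_of {: L} -> L.
Hypothesis cocf : cocycle2 f.

Lemma cocycleE s t r : s (f t r) * f s (gcomp t r) = f s t * f (gcomp s t) r.
Proof. by case: cocf. Qed.
Lemma cocycle1s s : f 1%g s = 1. Proof. by case: cocf => _ /(_ s)[]. Qed.
Lemma cocycles1 s : f s 1%g = 1. Proof. by case: cocf => _ /(_ s)[]. Qed.

Lemma cocycle_inv s : s (f s^-1%g s) = f s s^-1%g.
Proof.
by have := cocycleE s s^-1%g s; rewrite gcompVs gcompV cocycle1s cocycles1 !mulr1.
Qed.

Lemma cocycle_invV s : s^-1%g (f s s^-1%g) = f s^-1%g s.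
Proof. by rewrite -cocycle_inv galKVE. Qed.

Lemma cocycle_act_inv s t : s (f t t^-1%g) = f s t * f (gcomp s t) t^-1%g.
Proof. by rewrite -cocycleE gcompV cocycles1 mulr1. Qed.

(** With [h(s) = f(s, s^-1)], this carries membership in [M^2] from [h(s)] to [h(st)] whenever
    [f(s, t)] is not in [M]. *)
Lemma cocycle_mul_invl s t :
  s (f t (gcomp s t)^-1%g) * f s s^-1%g = f s t * f (gcomp s t) (gcomp s t)^-1%g.
Proof. by rewrite -cocycleE /gcomp invMg mulgKV. Qed.

(** Apply [r = st] to the cocycle identity for [r^-1, s, t]. It makes ideal conditions on [y h(t)]
    pass from degree [t] to degree [st] under left multiplication. *)
Lemma cocycle_mul_invr s t :
  f s t * f (gcomp s t) (gcomp s t)^-1%g =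
  gcomp s t (f (gcomp s t)^-1%g s) * s (f t t^-1%g).
Proof.
set r := gcomp s t; have := cocycleE r^-1%g s t; rewrite -/r => /(congr1 r).
have -> : gcomp r^-1%g s = t^-1%g by rewrite /r /gcomp invMg mulKVg.
by rewrite !rmorphM /= galVKE cocycle_inv [r (f t^-1%g t)]gcompE cocycle_inv.
Qed.

End Cocycle.

Section GaloisStable.
Variable (S : L -> Prop).
Hypothesis subS : is_subring S.
Hypothesis galS : forall s x, S x -> S (s x).

Lemma maximal_ideal_gal s M : maximal_ideal_in S M -> maximal_ideal_in S (fun x => M (s x)).
Proof.
have galI t I : is_ideal_in S I -> is_ideal_in S (fun x => I (t x)).
  move=> idI; split.
  - by move=> x Ix; rewrite -(galKVE t x); apply: galS; apply: ideal_in_sub Ix.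
  - by rewrite rmorph0; apply: ideal_in0 idI.
  - by move=> x y Ix Iy; rewrite rmorphB; apply: (ideal_inB idI).
  - by move=> c x Sc Ix; rewrite rmorphM; apply: (ideal_inMl idI) => //; apply: galS.
move=> [idM M1 Mmax]; split; [exact: galI | by rewrite rmorph1 |].
move=> N idN MN N1 x; rewrite -{1}(galKVE s x).
apply: (Mmax (fun y => N (s^-1%g y))); [exact: galI | | by rewrite rmorph1].
by move=> y My; apply: MN; rewrite galVKE.
Qed.

Lemma jacobson_ideal_gal s x : jacobson_ideal S x -> jacobson_ideal S (s x).
Proof.
move=> [Sx Jx]; split=> [|M maxM]; first exact: galS.
exact: (Jx _ (maximal_ideal_gal s maxM)).
Qed.

Lemma ideal_sq_gal s M x : ideal_sq M (s x) -> ideal_sq (fun y => M (s y)) x.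
Proof.
move=> [r [rM E]]; exists [seq (s^-1%g ab.1, s^-1%g ab.2) | ab <- r]; split.
  by move=> _ /mapP[ab /rM[Ma Mb] ->] /=; rewrite !galVKE.
rewrite -[x](galKVE s) E big_map rmorph_sum; apply: eq_bigr => ab _.
by rewrite rmorphM.
Qed.

End GaloisStable.
End GaloisAction.

(** * Graded left ideals and the graded Jacobson radical *)

Section GradedIdeals.
Variables (F : fieldType) (L : splittingFieldType F) (S : L -> Prop).
Variable f : gal_of {: L} -> gal_of {: L} -> L.
Hypothesis subS : is_subring S.
Hypothesis galS : forall (s : gal_of {: L}) x, S x -> S (s x).
Hypothesis Sf : forall s t, S (f s t).
Hypothesis cocf : cocycle2 f.
Implicit Types (s t r : gal_of {: L}) (a b : cp L).

(** A graded left ideal given by its components: [C r] holds the coefficients of [x_r], and the last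
    clause is closure under [(c x_s)(y x_t)]. *)
Definition graded_family (C : gal_of {: L} -> L -> Prop) : Prop :=
  [/\ forall r x, C r x -> S x, forall r, C r 0,
      forall r x y, C r x -> C r y -> C r (x - y) &
      forall s t c y, S c -> C t y -> C (gcomp s t) (c * s y * f s t)].

Definition homogeneous r (y : L) : cp L := [ffun q => if q == r then y else 0].

Lemma cp_mulE a b r :
  cp_mul f a b r = \sum_s a s * s (b (gcomp s^-1%g r)) * f s (gcomp s^-1%g r).
Proof.
rewrite ffunE; apply: eq_bigr => s _; apply: big_pred1 => t /=.
by apply/eqP/eqP => [<-|->]; [rewrite gcompA gcompVs gcomp1s | rewrite gcompKV].
Qed.

Lemma graded_familyD C r x y : graded_family C -> C r x -> C r y -> C r (x + y).
Proof.
case=> _ C0 CB _ Cx Cy; rewrite -[y]opprK; apply: (CB) => //.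
by rewrite -sub0r; apply: CB.
Qed.

Lemma graded_familyMl C r c y : graded_family C -> S c -> C r y -> C r (c * y).
Proof.
case=> _ _ _ CM Sc Cy; have := CM 1%g r c y Sc Cy.
by rewrite gcomp1s gal1E (cocycle1s cocf) mulr1.
Qed.

Lemma graded_family_ideal C :
  graded_family C -> graded_left_ideal S f (fun a => forall r, C r (a r)).
Proof.
move=> gC; have [CS C0 CB CM] := gC; split.
- by move=> a Ca r; apply: CS (Ca r).
- by move=> r; rewrite ffunE.
- by move=> a b Ca Cb r; rewrite ffunE; apply: CB.
- move=> a b Sa Cb r; rewrite cp_mulE; elim/big_rec: _ => // s x _ Cx.
  apply: graded_familyD Cx => //.
  by have := CM s (gcomp s^-1%g r) (a s) (b (gcomp s^-1%g r)) (Sa s) (Cb _); rewrite gcompKV.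
- by move=> a s Ca r; rewrite ffunE; case: eqP => [->|].
Qed.

Lemma cp_mul_homogeneous s t c y :
  cp_mul f (homogeneous s c) (homogeneous t y) = homogeneous (gcomp s t) (c * s y * f s t).
Proof.
apply/ffunP => r; rewrite cp_mulE (bigD1 s) //= big1 ?addr0 => [|q /negPf qs]; last first.
  by rewrite ffunE qs !mul0r.
rewrite !ffunE eqxx; have -> : (gcomp s^-1%g r == t) = (r == gcomp s t).
  by apply/eqP/eqP => [<-|->]; [rewrite gcompKV | rewrite gcompA gcompVs gcomp1s].
case: eqP => [->|_]; first by rewrite gcompA gcompVs gcomp1s.
by rewrite rmorph0 mulr0 mul0r.
Qed.

Lemma Af_homogeneous s y : S y -> Af S (homogeneous s y).
Proof. by move=> Sy r; rewrite ffunE; case: ifP => // _; apply: subring0. Qed.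

Lemma graded_ideal_family I :
  graded_left_ideal S f I -> graded_family (fun r y => I (homogeneous r y)).
Proof.
case=> IS I0 IB IM _; split.
- by move=> r x /IS /(_ r); rewrite ffunE eqxx.
- move=> r; have -> // : homogeneous r 0 = cp_zero L.
  by apply/ffunP => q; rewrite !ffunE if_same.
- move=> r x y Ix Iy.
  have -> : homogeneous r (x - y) = cp_sub (homogeneous r x) (homogeneous r y).
    by apply/ffunP => q; rewrite !ffunE; case: eqP; rewrite ?subr0.
  exact: IB.
- move=> s t c y Sc Iy; rewrite -cp_mul_homogeneous; apply: IM => //.
  exact: Af_homogeneous.
Qed.

Lemma graded_ideal_homogeneous I a :
  graded_left_ideal S f I -> I a <-> forall r, I (homogeneous r (a r)).
Proof.
case=> _ I0 IB _ Icomp; split=> [Ia r|Ia]; first exact: Icomp.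
pose part (l : seq (gal_of {: L})) : cp L := [ffun q => if q \in l then a q else 0].
suff /(_ (enum (@predT (gal_of {: L})))) : forall l, I (part l).
  by congr (I _); apply/ffunP => q; rewrite ffunE mem_enum.
elim=> [|r l IHl]; first by congr (I _): I0; apply/ffunP => q; rewrite !ffunE.
have [rl|rl] := boolP (r \in l).
  have -> // : part (r :: l) = part l.
  by apply/ffunP => q; rewrite !ffunE inE; case: eqP => // ->; rewrite rl.
(* Closure is available for differences only, so the sum is written as a double difference. *)
have -> : part (r :: l) = cp_sub (part l) (cp_sub (cp_zero L) (homogeneous r (a r))).
  apply/ffunP => q; rewrite !ffunE inE sub0r opprK.
  by case: eqP => [->|_]; rewrite ?(negPf rl) ?add0r ?addr0.
by apply: (IB) => //; apply: IB.
Qed.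

Lemma graded_ideal_proper I : graded_left_ideal S f I ->
  proper_in S I <-> ~ I (homogeneous 1%g 1).
Proof.
move=> gI; split=> [[a [Sa Ia]] I1|I1]; last first.
  exists (homogeneous 1%g 1); split=> //; apply: Af_homogeneous; exact: subring1.
apply: Ia; apply/(graded_ideal_homogeneous _ gI) => r.
have [_ _ _ CM] := graded_ideal_family gI.
by have := CM r 1%g (a r) 1 (Sa r) I1; rewrite gcomps1 rmorph1 (cocycles1 cocf) !mulr1.
Qed.

Section MaximalGradedOver.
Variables (M : L -> Prop) (maxM : maximal_ideal_in S M).

(* The components of the largest graded left ideal whose component at 1 lies in M. *)
Let C r y := S y /\ M (r^-1%g (y * f r r^-1%g)).

Lemma max_graded_over_family : graded_family C.
Proof.
have [idM _ _] := maxM; split.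
- by move=> r x [].
- by move=> r; split; rewrite ?mul0r ?rmorph0; [apply: subring0 | apply: (ideal_in0 idM)].
- move=> r x y [Sx Mx] [Sy My]; split; first exact: subringB.
  by rewrite mulrBl rmorphB; apply: (ideal_inB idM).
- move=> s t c y Sc [Sy My]; split.
    by do 2?apply: subringM => //; apply: galS.
  set r := gcomp s t; rewrite -mulrA (cocycle_mul_invr cocf) -/r.
  have -> : c * s y * (r (f r^-1%g s) * s (f t t^-1%g)) =
      c * r (f r^-1%g s) * s (y * f t t^-1%g) by rewrite rmorphM; ring.
  have -> : s (y * f t t^-1%g) = r (t^-1%g (y * f t t^-1%g)) by rewrite gcompE galVKE.
  rewrite !rmorphM /= !galKVE -rmorphM; apply: (ideal_inMl idM) => //.
  by apply: subringM => //; apply: galS.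
Qed.

(** A proper graded left ideal above this one has degree 1 component exactly [M]. Multiplying its
    element [y x_r] by [x_{r^-1}] lands in degree 1 with coefficient [r^-1(y h(r))], which is
    therefore in [M]. *)
Lemma max_graded_over : max_graded_left_ideal S f (fun a => forall r, C r (a r)).
Proof.
have [idM M1 Mmax] := maxM; have gC := graded_family_ideal max_graded_over_family.
have C1 y : C 1%g y <-> M y.
  rewrite /C invg1 gal1E (cocycle1s cocf) mulr1; split=> [[]//|My]; split=> //.
  exact: ideal_in_sub My.
split=> //.
  apply/(graded_ideal_proper gC) => /(_ 1%g); rewrite ffunE eqxx => /C1; exact: M1.
move=> I gI pI CI x; split; last exact: CI.
have gF := graded_ideal_family gI; have [FS F0 FB FM] := gF.
have MF y : M y -> I (homogeneous 1%g y).
  move=> My; apply: CI => r; rewrite ffunE; case: eqP => [->|_]; first exact/C1.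
  by case: max_graded_over_family.
have FM1 y : I (homogeneous 1%g y) -> M y.
  move=> Iy; apply/(Mmax (fun y => I (homogeneous 1%g y))) => //.
    split; [by move=> z; apply: FS | exact: F0 | by move=> u v; apply: FB |].
    by move=> u v Su; apply: (graded_familyMl gF).
  exact/(graded_ideal_proper gI).
move=> /(graded_ideal_homogeneous _ gI) Ix r; split; first exact: FS (Ix r).
rewrite rmorphM /= (cocycle_invV cocf); apply: FM1.
have := FM r^-1%g r 1 (x r) (subring1 subS) (Ix r).
by rewrite gcompVs mul1r.
Qed.

End MaximalGradedOver.

Section GenerateByHomogeneous.
Variables (C : gal_of {: L} -> L -> Prop) (gC : graded_family C).
Variables (r : gal_of {: L}) (y : L) (Sy : S y).

(** The components of the sum of [C] and the left ideal generated by [y x_r]; in degree [q] only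
    multipliers of degree [q r^-1] contribute. *)
Let C' q z := exists i c, [/\ C q i, S c &
  z = i + c * (gcomp q r^-1%g) y * f (gcomp q r^-1%g) r].

Lemma graded_family_adjoin : graded_family C'.
Proof.
have [CS C0 CB CM] := gC; split.
- move=> q z [i [c [Ci Sc ->]]]; apply: subringD => //; first exact: CS Ci.
  by do 2?apply: subringM => //; apply: galS.
- by move=> q; exists 0, 0; split; rewrite ?mul0r ?addr0 //; apply: subring0.
- move=> q _ _ [i [c [Ci Sc ->]]] [j [d [Cj Sd ->]]]; exists (i - j), (c - d).
  by split; [apply: CB | apply: subringB | ring].
- move=> s t b _ Sb [i [c [Ci Sc ->]]]; set u := gcomp t r^-1%g.
  exists (b * s i * f s t), (b * s c * f s u); split; first exact: CM.
    by do 2?apply: subringM => //; apply: galS.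
  have uE : gcomp (gcomp s t) r^-1%g = gcomp s u by rewrite /u gcompA.
  have tE : gcomp u r = t by rewrite /u -gcompA gcompVs gcomps1.
  rewrite uE gcompE rmorphD !rmorphM mulrDr mulrDl; congr (_ + _).
  have := cocycleE cocf s u r; rewrite tE => E.
  transitivity (b * s c * s (u y) * (s (f u r) * f s t)); first by ring.
  by rewrite E; ring.
Qed.

End GenerateByHomogeneous.

(** For one direction, use the maximal graded left ideals above the pullbacks of [M] along [r]. For
    the other, if [y x_r] avoids a maximal [I], adjoining it gives [1 = i + c r^-1(y h(r))] with [i]
    in degree 1 of [I]; the last term is in [J(S)], so [i] is a unit and [I] is not proper. *)
Lemma graded_jacobsonP a : graded_jacobson S f a <->
  forall r, S (a r) /\ jacobson_ideal S (a r * f r r^-1%g).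
Proof.
split=> [[Sa Ja] r|Ja].
  split=> //; split=> [|M maxM]; first exact: subringM.
  have maxMr := maximal_ideal_gal galS r maxM.
  by have [_] := Ja _ (max_graded_over maxMr) r; rewrite galVKE.
split=> [r|I [gI pI Imax]]; first by case: (Ja r).
apply/(graded_ideal_homogeneous _ gI) => r; apply: contrapT => Ir.
have [Sy Jy] := Ja r; set y := a r in Ir Sy Jy.
have gC := graded_ideal_family gI; have [CS C0 CB CM] := gC.
have gC' := graded_family_adjoin gC r Sy.
have gI' := graded_family_ideal gC'.
set I' := (X in graded_left_ideal S f X) in gI'.
have II' b : I b -> I' b.
  move=> /(graded_ideal_homogeneous _ gI) Ib q; exists (b q), 0; split=> //.
    exact: subring0.
  by rewrite !mul0r addr0.
have I'y : I' (homogeneous r y).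
  move=> q; rewrite ffunE; case: eqP => [->|_]; last by case: gC'.
  exists 0, 1; split; rewrite ?gcompV ?gal1E ?(cocycle1s cocf) ?mul1r ?mulr1 ?add0r //.
  exact: subring1.
have [pI'|] := pselect (proper_in S I').
  by apply: Ir; apply/(Imax _ gI' pI' II').
move/(graded_ideal_proper gI')/contrapT => /(_ 1%g); rewrite ffunE eqxx.
move=> [i [c [Ci Sc]]]; rewrite gcomp1s -(cocycle_invV cocf) -mulrA -rmorphM => E.
have [u0 Su] : 1 - c * r^-1%g (y * f r r^-1%g) != 0 /\
    S (1 - c * r^-1%g (y * f r r^-1%g))^-1.
  apply: jacobson_unit => //; apply: (ideal_inMl (jacobson_ideal_ideal subS)) => //.
  exact: jacobson_ideal_gal.
move/(graded_ideal_proper gI): pI; apply; rewrite -(mulVf u0).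
apply: (graded_familyMl gC) => //.
by rewrite {1}E addrK.
Qed.

End GradedIdeals.

(** * The left order of the graded Jacobson radical *)

Section LeftOrder.
Variables (F : fieldType) (L : splittingFieldType F) (V : F -> Prop) (p : F).
Variable f : gal_of {: L} -> gal_of {: L} -> L.
Hypothesis valV : valuation_ring V.
Hypothesis Vp : V p.
Hypothesis radV : forall x, jacobson_val V x <-> exists v, V v /\ x = v * p.
Let S := @integral_over F L V.
Hypothesis Sf : forall s t, S (f s t).
Hypothesis f_neq0 : forall s t, f s t != 0.
Hypothesis cocf : cocycle2 f.

Let subS : is_subring S. Proof. by case: valV => subV _; apply: integral_over_subring. Qed.
Let galS (s : gal_of {: L}) x : S x -> S (s x). Proof. exact: integral_over_gal. Qed.
Let JP := graded_jacobsonP subS galS Sf cocf.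

Lemma Af_sub_left_order x : Af S x -> left_order f (graded_jacobson S f) x.
Proof.
move=> Sx y [Sy Jy]; split=> [|I maxI]; last first.
  by have [[_ _ _ IM _] _ _] := maxI; apply: IM => //; apply: Jy.
move=> r; rewrite cp_mulE; apply: subring_sum => // s _.
by do 2?apply: subringM => //; apply: galS.
Qed.

Lemma left_order_sub_Af :
  (forall (s : gal_of {: L}) M, maximal_ideal_in S M -> ~ ideal_sq M (f s s^-1%g)) ->
  forall x, left_order f (graded_jacobson S f) x -> Af S x.
Proof.
move=> M2f x Ox s; apply: (jacobson_ideal_stabilizer valV Vp radV) => j Jj.
have Sjf : S (j / f s s^-1%g).
  exact: (jacobson_ideal_dvd valV Jj (Sf _ _) (f_neq0 _ _) (M2f _)).
(* Chosen so that [x] times [z x_{s^-1}] has coefficient [x_s j] in degree 1. *)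
pose z := s^-1%g (j / f s s^-1%g).
have Jz : graded_jacobson S f (homogeneous s^-1%g z).
  apply/JP => r; rewrite ffunE; case: eqP => [->|_]; last first.
    by rewrite mul0r; split; [apply: subring0 | apply: ideal_in0; apply: jacobson_ideal_ideal].
  split; first exact: galS.
  rewrite invgK -(cocycle_invV cocf) -rmorphM divfK //; exact: jacobson_ideal_gal.
have /JP/(_ 1%g)[_] := Ox _ Jz.
rewrite invg1 (cocycle1s cocf) mulr1 cp_mulE (bigD1 s) //= big1 => [|t ts]; last first.
  rewrite ffunE gcomps1 (inj_eq invg_inj) (negPf ts) rmorph0 mulr0 mul0r //.
by rewrite ffunE gcomps1 eqxx addr0 galVKE -mulrA divfK.
Qed.

Lemma left_order_not_sub_Af s0 M : maximal_ideal_in S M -> ideal_sq M (f s0 s0^-1%g) ->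
  exists x, left_order f (graded_jacobson S f) x /\ ~ Af S x.
Proof.
move=> maxM M2f0; have [idM M1 _] := maxM.
(* For [p = 0] the ring [S] is the field [L], and a nonzero cocycle value cannot lie in [M]. *)
have p0 : p != 0.
  apply/eqP => p0; apply: (maximal_ideal_nunit maxM (f_neq0 s0 s0^-1%g)).
    exact: (integral_over_trivial valV radV).
  exact: (ideal_sq_sub maxM M2f0).
have [k Sk kM] := maximal_ideal_inverse valV Vp radV p0 maxM.
(* By the cocycle identity, t \in up s is a preorder; minimizing #|up s| yields a maximal s. *)
pose up s := [pred t | `[< ~ M (f s (gcomp s^-1%g t)) >]].
have upP u t : reflect (~ M (f u (gcomp u^-1%g t))) (t \in up u) by apply: asboolP.
pose sq s := `[< ideal_sq M (f s s^-1%g) >].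
have sq0 : sq s0 by apply/asboolP.
case: (arg_minnP (fun s => #|up s|) sq0) => s /asboolP M2s smin.
have up_sq t : ~ M (f s t) -> ideal_sq M (f (gcomp s t) (gcomp s t)^-1%g).
  move=> Mst; apply: (ideal_sq_cancel subS maxM _ _ Mst) => //.
  rewrite -(cocycle_mul_invl cocf); apply: (ideal_sqMl maxM) => //; exact: galS.
(* By transitivity [up r] is contained in [up s], and [r] still satisfies the [M^2] condition;
   minimality gives equality, so [s] is in [up r]. *)
have up_sym t : ~ M (f s t) -> ~ M (f (gcomp s t) t^-1%g).
  move=> Mst; set r := gcomp s t.
  have sub : {subset up r <= up s}.
    move=> u /upP Mru; apply/upP.
    have := cocycleE cocf s t (gcomp r^-1%g u).
    have -> : gcomp t (gcomp r^-1%g u) = gcomp s^-1%g u.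
      by rewrite /r /gcomp invMg -!mulgA mulVg mulg1.
    move=> E Msu; have : M (f s t * f r (gcomp r^-1%g u)).
      by rewrite -E; apply: (ideal_inMl idM) => //; apply: galS.
    exact: (maximal_ideal_nmul subS maxM).
  have card_le : (#|up s| <= #|up r|)%N by apply: smin; apply/asboolP; apply: up_sq.
  have : s \in up s.
    by apply/upP; rewrite gcompVs (cocycles1 cocf).
  have /subset_cardP sub_eq : #|up r| = #|up s|.
    by apply/eqP; rewrite eqn_leq card_le andbT; apply: subset_leq_card; apply/fintype.subsetP.
  rewrite -(sub_eq (introT fintype.subsetP sub)) => /upP.
  by rewrite /r /gcomp invMg mulgA mulgV mul1g.
exists (homogeneous s k); split; last by move=> /(_ s); rewrite ffunE eqxx.
move=> y /JP Jy; apply/JP => r; rewrite cp_mulE (bigD1 s) //= big1 => [|q /negPf qs]; last first.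
  by rewrite ffunE qs !mul0r.
rewrite ffunE eqxx addr0; set t := gcomp s^-1%g r.
have rE : r = gcomp s t by rewrite gcompKV.
have [Sy Jyt] := Jy t.
set z := s (y t) * f s t.
have Sz : S z by apply: subringM => //; apply: galS.
have Jsy : jacobson_ideal S (s (y t) * s (f t t^-1%g)).
  by rewrite -rmorphM; apply: jacobson_ideal_gal.
have Jzr : jacobson_ideal S (z * f r r^-1%g).
  rewrite /z -mulrA rE (cocycle_mul_invr cocf) mulrCA.
  by apply: (ideal_inMl (jacobson_ideal_ideal subS)) => //; apply: galS.
(* If [f s t] is outside [M], so is [f(st, t^-1)], and its product with [z] is [s(y_t h(t))], an
   element of [J(S)]. *)
have Mz : M z.
  have [Mst|Mst] := pselect (M (f s t)).
    by apply: (ideal_inMl idM) => //; apply: galS.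
  apply: (maximal_ideal_prime subS maxM _ _ _ (up_sym _ Mst)) => //.
  rewrite mulrC /z -mulrA -(cocycle_act_inv cocf); exact: (proj2 Jsy).
rewrite -mulrA -/z; split; first exact: kM.
split=> [|M' maxM']; first by apply: subringM => //; apply: kM.
have [idM' M'1 Mmax'] := maxM'.
have Skz := kM _ Mz.
(* At a maximal ideal other than [M], some [m] in [M] outside [M'] clears [k]: the product [k m] is
   in [S] and [z h(r)] is in [J(S)]. *)
have [[m Mm M'm]|MM'] := pselect (exists2 m, M m & ~ M' m).
  have Sm := ideal_in_sub idM Mm.
  apply: (maximal_ideal_prime subS maxM' Sm _ _ M'm); first exact: subringM.
  have -> : m * (k * z * f r r^-1%g) = k * m * (z * f r r^-1%g) by ring.
  by apply: (ideal_inMl idM'); [apply: kM | apply: (proj2 Jzr)].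
have {}MM' x : M' x <-> M x.
  have [_ _ Mmax] := maxM; apply: Mmax => // m Mm.
  by apply: contrapT => M'm; apply: MM'; exists m.
apply/MM'; have [Mr|Mr] := pselect (M (f r r^-1%g)).
  exact: (ideal_inMl idM).
(* Here [f r r^-1] gives no factor in [M]; the cocycle identity trades [f(s, t) h(r)] for a multiple
   of [h(s)], and [k M^2] is contained in [M]. *)
have [l [lM lE]] := M2s.
have -> : k * z * f r r^-1%g = s (y t) * s (f t r^-1%g) * (k * f s s^-1%g).
  rewrite /z; have := cocycle_mul_invl cocf s t; rewrite -rE => E.
  transitivity (k * s (y t) * (f s t * f r r^-1%g)); first by ring.
  by rewrite -E; ring.
apply: (ideal_inMl idM); first by apply: subringM => //; apply: galS.
rewrite lE mulr_sumr big_seq; apply: (ideal_in_sum idM) => ab /lM[Ma Mb].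
by rewrite mulrA; apply: (ideal_inMl idM) => //; apply: kM.
Qed.

End LeftOrder.

Theorem theorem2p8 (F : fieldType) (L : splittingFieldType F) (V : F -> Prop)
  (f : gal_of {: L} -> gal_of {: L} -> L) :
  valuation_ring V ->
  jacobson_principal V ->
  galois 1%VS {: L}%VS ->
  (forall s t, integral_over V (f s t) /\ f s t != 0) ->
  cocycle2 f ->
  let S := integral_over V in
  ((forall x, left_order f (graded_jacobson S f) x <-> Af S x) <->
   (forall (s : gal_of {: L}) M, maximal_ideal_in S M -> ~ ideal_sq M (f s (s^-1)%g)))
  /\
  ((forall (s : gal_of {: L}) M, maximal_ideal_in S M -> ~ ideal_sq M (f s (s^-1)%g)) <->
   (forall (s t : gal_of {: L}) M, maximal_ideal_in S M -> ~ ideal_sq M (f s t))).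
Proof.
move=> valV [p [Vp radV]] _ Sf0 cocf S.
have Sf s t : S (f s t) by case: (Sf0 s t).
have f0 s t : f s t != 0 by case: (Sf0 s t).
have subS : is_subring S by case: valV => subV _; apply: integral_over_subring.
have galS (s : gal_of {: L}) x : S x -> S (s x) by apply: integral_over_gal.
split; split.
- move=> O_Af s M maxM M2s.
  have [x [Ox]] := left_order_not_sub_Af valV Vp radV Sf f0 cocf maxM M2s.
  by apply; apply/O_Af.
- move=> M2f x; split; first exact: (left_order_sub_Af valV Vp radV Sf f0 cocf M2f).
  exact: (Af_sub_left_order valV Sf).
- move=> M2f s t M maxM M2st.
  (* The hypothesis on [h(t)] is used at the pullback of [M] along [s], because it is [s(h(t))] that
     [f(s, t)] divides. *)
  apply: (M2f t _ (maximal_ideal_gal galS s maxM)); apply: ideal_sq_gal.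
  rewrite (cocycle_act_inv cocf) mulrC; exact: (ideal_sqMl maxM).
- by move=> M2f s M; apply: M2f.
Qed.
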